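(* Let $(A,\vdash,\perp,\dashv)$ be a trigroup with distinguished bar-unit $1$. Define a ternary operation $[-,-,-]:A\times A\times A\to A$ by $$[x,y,z]=(x\perp y)\vdash z\dashv (y^{-1}\perp x^{-1}).$$ Then $(A,[-,-,-])$ is a $3$-rack pointed at $1$.
   Context: A trisemigroup $(A,\vdash,\perp,\dashv)$ is a set $A$ with three binary operations, each associative, such that for all $x,y,z\in A$: (i) $x\vdash(y\vdash z)=(x\dashv y)\vdash z$, $x\vdash(y\dashv z)=(x\vdash y)\dashv z$, $x\dashv(y\dashv z)=x\dashv(y\vdash z)$; (ii) $x\vdash(y\vdash z)=(x\perp y)\vdash z$, $x\vdash(y\perp z)=(x\vdash y)\perp z$; (iii) $x\dashv(y\dashv z)=x\dashv(y\perp z)$, $(x\perp y)\dashv z=x\perp(y\dashv z)$; (iv) $(x\dashv y)\perp z=x\perp(y\vdash z)$. A trimonoid is a trisemigroup $A$ with a (distinguished) element $1\in A$ such that $1\vdash x=x=x\dashv 1$ for all $x\in A$. An element $e\in A$ is a bar-unit if $e\vdash x=x=x\dashv e$ for all $x\in A$. A trigroup is a trimonoid such that for every $x\in A$ there exists $x^{-1}\in A$ (the inverse of $x$, with respect to the distinguished bar-unit $1$) with $x\vdash x^{-1}=1=x^{-1}\dashv x$ and $x\perp x^{-1}=1=x^{-1}\perp x$. The expression $a\vdash z\dashv b$ is unambiguous since $(a\vdash z)\dashv b=a\vdash(z\dashv b)$. A $3$-rack $(R,[-,-,-])$ is a set $R$ with a ternary operation such that: (3r1) $[x_1,x_2,[y_1,y_2,z]]=[[x_1,x_2,y_1],[x_1,x_2,y_2],[x_1,x_2,z]]$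 for all $x_1,x_2,y_1,y_2,z\in R$; (3r2) for all $x,y,b\in R$ there exists a unique $z\in R$ with $[x,y,z]=b$. It is pointed at $1\in R$ if in addition (3r3) $[1,1,z]=z$ and $[x_1,x_2,1]=1$ for all $x_1,x_2,z\in R$. *)

(* Defs.v *)
From HB Require Import structures.
From mathcomp Require Import all_boot.
From mathcomp Require Import boolp.

Set Implicit Arguments.
Unset Strict Implicit.
Unset Printing Implicit Defensive.

Declare Scope tri_scope.
Delimit Scope tri_scope with tri.
Local Open Scope tri_scope.

(* The three operations share one level and associate to the left, so that
   a ⊢ z ⊣ b is read as (a ⊢ z) ⊣ b, which equals a ⊢ (z ⊣ b). *)
Reserved Notation "x ⊢ y" (at level 40, left associativity).
Reserved Notation "x ⊥ y" (at level 40, left associativity).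
Reserved Notation "x ⊣ y" (at level 40, left associativity).

HB.mixin Record isTrisemigroup (A : Type) := {
  vdash : A -> A -> A;
  perp : A -> A -> A;
  dashv : A -> A -> A;
  vdashA : associative vdash;
  perpA : associative perp;
  dashvA : associative dashv;
  vdash_vdash_dashv : forall x y z : A,
    vdash x (vdash y z) = vdash (dashv x y) z;
  vdash_dashvA : forall x y z : A,
    vdash x (dashv y z) = dashv (vdash x y) z;
  dashv_dashv_vdash : forall x y z : A,
    dashv x (dashv y z) = dashv x (vdash y z);
  vdash_vdash_perp : forall x y z : A,
    vdash x (vdash y z) = vdash (perp x y) z;
  vdash_perpA : forall x y z : A,
    vdash x (perp y z) = perp (vdash x y) z;
  dashv_dashv_perp : forall x y z : A,
    dashv x (dashv y z) = dashv x (perp y z);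
  perp_dashvA : forall x y z : A,
    dashv (perp x y) z = perp x (dashv y z);
  dashv_perp_vdash : forall x y z : A,
    perp (dashv x y) z = perp x (vdash y z)
}.

#[short(type="trisemigroupType")]
HB.structure Definition Trisemigroup := { A of isTrisemigroup A }.

Notation "x ⊢ y" := (vdash x y) : tri_scope.
Notation "x ⊥ y" := (perp x y) : tri_scope.
Notation "x ⊣ y" := (dashv x y) : tri_scope.

Definition is_bar_unit (A : trisemigroupType) (e : A) : Prop :=
  forall x : A, e ⊢ x = x /\ x ⊣ e = x.

HB.mixin Record isTrimonoid A of Trisemigroup A := {
  tri1 : A;
  tri1_bar_unit : is_bar_unit tri1
}.

#[short(type="trimonoidType")]
HB.structure Definition Trimonoid := { A of Trisemigroup A & isTrimonoid A }.

Notation "1" := tri1 : tri_scope.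

Definition is_inverse (A : trimonoidType) (x y : A) : Prop :=
  [/\ x ⊢ y = 1, y ⊣ x = 1, x ⊥ y = 1 & y ⊥ x = 1].

HB.mixin Record isTrigroup A of Trimonoid A := {
  ex_inverse : forall x : A, exists y : A, is_inverse x y
}.

#[short(type="trigroupType")]
HB.structure Definition Trigroup := { A of Trimonoid A & isTrigroup A }.

(* The choice made here is immaterial, see is_inverse_unique. *)
Definition triinv (A : trigroupType) (x : A) : A := sval (cid (ex_inverse x)).

Notation "x ^-1" := (triinv x) : tri_scope.

Lemma triinvP (A : trigroupType) (x : A) : is_inverse x x^-1.
Proof. exact: svalP (cid (ex_inverse x)). Qed.

Lemma is_inverse_unique (A : trimonoidType) (x y z : A) :
  is_inverse x y -> is_inverse x z -> y = z.
Proof.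
have unit1 (u v : A) : is_inverse x u -> is_inverse x v -> u = v ⊢ 1.
  move=> [xu _ _ _] [_ vx _ _].
  have [<- _] := tri1_bar_unit u.
  by rewrite -vx -vdash_vdash_dashv xu vx.
move=> xy xz.
by rewrite (unit1 _ _ xy xz) -(unit1 _ _ xz xz).
Qed.

Definition tri_bracket (A : trigroupType) (x y z : A) : A :=
  (x ⊥ y) ⊢ z ⊣ (y^-1 ⊥ x^-1).

Record is_3rack (R : Type) (br : R -> R -> R -> R) : Prop := {
  rack3_distr : forall x1 x2 y1 y2 z : R,
    br x1 x2 (br y1 y2 z) = br (br x1 x2 y1) (br x1 x2 y2) (br x1 x2 z);
  rack3_div : forall x y b : R, exists! z : R, br x y z = b
}.

Record is_pointed_3rack (R : Type) (br : R -> R -> R -> R) (e : R) : Prop := {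
  pointed_3rack_rack : is_3rack br;
  pointed_3rack_id : forall z : R, br e e z = z;
  pointed_3rack_fix : forall x1 x2 : R, br x1 x2 e = e
}.

(* Main.v *)
Require Import Defs.
From mathcomp Require Import all_boot.

(** The products [x ⊢ y], [x ⊥ y] and [x ⊣ y] differ in general, but as left
    factors of [⊢] they all act as [y] followed by [x], and as right factors
    of [⊣] they all act as [x] followed by [y]. The two actions commute, hence
    the bracket is a composite of two conjugations [c_x z = x ⊢ z ⊣ x^-1]
    ([tri_bracket_conj]), and the ternary statement follows from binary facts
    about [c].

    Both [x ⊢ -] and [- ⊣ x] are invertible, with inverses given by [x^-1], so
    each [c_x] is a bijection. The action of a conjugate is the conjugate of
    the action, which gives [c_x (c_y z) = c_(c_x y) (c_x z)]
    ([tri_conj_distr]); pushing two conjugations through two others is the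
    distributivity of the bracket.
    Finally [c_1] is the identity and every [c_x] fixes [1], because
    [1 ⊣ x^-1 = x^-1] although [1] need not be a left unit for [⊣]. *)

Set Implicit Arguments.
Unset Strict Implicit.
Unset Printing Implicit Defensive.

Local Open Scope tri_scope.

Lemma vdash1l (A : trimonoidType) (x : A) : 1 ⊢ x = x.
Proof. by have [] := tri1_bar_unit x. Qed.

Lemma dashv1r (A : trimonoidType) (x : A) : x ⊣ 1 = x.
Proof. by have [] := tri1_bar_unit x. Qed.

Section Trigroup.
Variable A : trigroupType.
Implicit Types x y z : A.

(** The product [x^-1 ⊢ x] may differ from [1], but it acts from the left as
    [x^-1 ⊣ x], which is [1]. *)
Lemma vdashVK x z : x^-1 ⊢ (x ⊢ z) = z.
Proof.
have [_ vx _ _] := triinvP x.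
by rewrite vdash_vdash_dashv vx vdash1l.
Qed.

Lemma vdashKV x z : x ⊢ (x^-1 ⊢ z) = z.
Proof.
have [xv _ _ _] := triinvP x.
by rewrite vdashA xv vdash1l.
Qed.

Lemma dashvVK x z : z ⊣ x^-1 ⊣ x = z.
Proof.
have [_ vx _ _] := triinvP x.
by rewrite -dashvA vx dashv1r.
Qed.

(** On the right, [x ⊣ x^-1] can be replaced by [x ⊢ x^-1], which is [1]. *)
Lemma dashvKV x z : z ⊣ x ⊣ x^-1 = z.
Proof.
have [xv _ _ _] := triinvP x.
by rewrite -dashvA dashv_dashv_vdash xv dashv1r.
Qed.

Lemma dashvI x y z : y ⊣ x = z ⊣ x -> y = z.
Proof. by move=> eq_yz; rewrite -(dashvKV x y) eq_yz dashvKV. Qed.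

Lemma triinv1 : (1 : A)^-1 = 1.
Proof. by have [h _ _ _] := triinvP (1 : A); rewrite -[LHS]vdash1l. Qed.

(** Although [1 ⊣ z] differs from [z] in general, an inverse absorbs [1] on this
    side as well: write [1] as [x^-1 ⊣ x] and cancel [x] against [x^-1]. *)
Lemma dashv1V x : 1 ⊣ x^-1 = x^-1.
Proof.
have [_ vx _ _] := triinvP x.
by rewrite -{1}vx dashvKV.
Qed.

Definition tri_conj x z : A := x ⊢ z ⊣ x^-1.

(** The right factor [y^-1 ⊥ x^-1] acts as [y^-1] followed by [x^-1], the
    reversed order that makes the bracket a composite. *)
Lemma tri_bracket_conj x y z :
  tri_bracket x y z = tri_conj x (tri_conj y z).
Proof.
by rewrite /tri_bracket /tri_conj -vdash_vdash_perp -dashv_dashv_perp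
           vdash_dashvA dashvA.
Qed.

Lemma tri_conjK x : cancel (tri_conj x) (fun z => x^-1 ⊢ z ⊣ x).
Proof. by move=> z; rewrite /tri_conj -vdash_dashvA dashvVK vdashVK. Qed.

Lemma tri_conjVK x : cancel (fun z => x^-1 ⊢ z ⊣ x) (tri_conj x).
Proof. by move=> z; rewrite /tri_conj vdash_dashvA dashvKV vdashKV. Qed.

Lemma vdash_conj x y z : tri_conj x y ⊢ z = x ⊢ (y ⊢ (x^-1 ⊢ z)).
Proof. by rewrite /tri_conj -vdash_vdash_dashv -vdashA. Qed.

Lemma dashv_conj x y z : z ⊣ tri_conj x y = z ⊣ x ⊣ y ⊣ x^-1.
Proof.
by rewrite /tri_conj -vdash_dashvA -dashv_dashv_vdash !dashvA.
Qed.

(** Self-distributivity. The left actions match by [vdash_conj]; on the right,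
    the inverse of [tri_conj x y] occurs, and multiplying by [tri_conj x y]
    itself avoids having to compute it. *)
Lemma tri_conj_distr x y z :
  tri_conj x (tri_conj y z) = tri_conj (tri_conj x y) (tri_conj x z).
Proof.
apply: (@dashvI (tri_conj x y)).
rewrite [in RHS]/tri_conj dashvVK -!/(tri_conj _ _) vdash_conj dashv_conj.
by rewrite /tri_conj !vdash_dashvA !dashvVK vdashVK.
Qed.

Lemma tri_conj1l z : tri_conj 1 z = z.
Proof. by rewrite /tri_conj triinv1 vdash1l dashv1r. Qed.

Lemma tri_conj1r x : tri_conj x 1 = 1.
Proof.
have [xv _ _ _] := triinvP x.
by rewrite /tri_conj -vdash_dashvA dashv1V.
Qed.

End Trigroup.

Theorem proposition4p1 (A : trigroupType) :
  is_pointed_3rack (@tri_bracket A) (@tri1 A).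
Proof.
split; first split.
- by move=> x1 x2 y1 y2 z; rewrite !tri_bracket_conj -!tri_conj_distr.
- move=> x y b.
  exists (y^-1 ⊢ (x^-1 ⊢ b ⊣ x) ⊣ y); split.
    by rewrite tri_bracket_conj (tri_conjVK y) (tri_conjVK x).
  by move=> z <-; rewrite tri_bracket_conj !tri_conjK.
- by move=> z; rewrite tri_bracket_conj !tri_conj1l.
- by move=> x1 x2; rewrite tri_bracket_conj !tri_conj1r.
Qed.
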